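(* Let $k$ be a commutative ring of characteristic $2$ and let $A$ be a commutative $k$-algebra. Then $\operatorname{IDer}_k(A;5)=\operatorname{IDer}_k(A;6)$.
   Context: For a commutative ring $k$, a commutative $k$-algebra $A$ and an integer $m\geq 1$, a Hasse-Schmidt derivation of $A$ over $k$ of length $m$ is a sequence $D=(D_0,D_1,\ldots,D_m)$ of $k$-linear maps $D_n:A\to A$ with $D_0=\mathrm{Id}_A$ and $D_n(xy)=\sum_{i+j=n}D_i(x)D_j(y)$ for all $x,y\in A$ and all $n\le m$. The set of these is $\operatorname{HS}_k(A;m)$. $\operatorname{IDer}_k(A;m)$ denotes the set of $k$-derivations $\delta$ of $A$ for which there is $D\in \operatorname{HS}_k(A;m)$ with $D_1=\delta$. *)

(* Defs.v *)
From mathcomp Require Import all_boot all_order all_algebra.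
From mathcomp Require Import boolp classical_sets.

Set Implicit Arguments.
Unset Strict Implicit.
Unset Printing Implicit Defensive.

Import GRing.Theory.
Local Open Scope ring_scope.
Local Open Scope classical_set_scope.

(* A commutative k-algebra is given by a commutative ring A together with its
   structure morphism phi : k -> A, so that c *: x is [phi c * x]. MathComp's
   [comAlgType k] is not used because it excludes the zero algebra; for
   [A : comAlgType k], phi is [in_alg A]. *)

Definition alg_linear (k A : comPzRingType) (phi : {rmorphism k -> A})
    (f : A -> A) : Prop :=
  forall (c : k) (x y : A), f (phi c * x + y) = phi c * f x + f y.

Definition Der (k A : comPzRingType) (phi : {rmorphism k -> A}) :
    set (A -> A) :=
  [set d | alg_linear phi d /\ forall x y, d (x * y) = d x * y + x * d y].

Definition HS (k A : comPzRingType) (phi : {rmorphism k -> A}) (m : nat) :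
    set ('I_m.+1 -> A -> A) :=
  [set D | [/\ forall n, alg_linear phi (D n),
               D ord0 = id
             & forall (n : 'I_m.+1) (x y : A),
                 D n (x * y) =
                 \sum_(i < m.+1) \sum_(j < m.+1 | (i + j == n)%N)
                   D i x * D j y]].
Arguments HS {k A} phi m.

(* Only meaningful for [1 <= m]: then [inord 1 : 'I_m.+1] is the index 1. *)
Definition IDer (k A : comPzRingType) (phi : {rmorphism k -> A}) (m : nat) :
    set (A -> A) :=
  [set d | Der phi d /\ exists2 D, HS phi m D & D (inord 1) = d].

(* Main.v *)
Require Import Defs.
From mathcomp Require Import all_boot all_order all_algebra.
From mathcomp Require Import boolp classical_sets.
From mathcomp Require Import ring.

Set Implicit Arguments.
Unset Strict Implicit.
Unset Printing Implicit Defensive.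

Import GRing.Theory.
Local Open Scope ring_scope.
Local Open Scope classical_set_scope.

(** Truncation gives one inclusion.  For the other, let [D] be a Hasse-Schmidt
    derivation and put [a = D_1], [b = D_2], [s = b + a^2].  In characteristic
    2, [s] is the degree 2 coefficient of the inverse of [1 + a t + b t^2], and
    every power [a^(2^i)] is a derivation.  A new sequence [F] with [F_1 = a]
    is built from [D_0, ..., D_4] alone.

    The guide is the logarithmic derivative [t F'(t) = e(t) F(t)], all of whose
    coefficients [e_n] are derivations.  Its [n]-th coefficient expresses
    [n F_n] through lower terms up to the derivation [e_n], so that for odd [n]
    one may choose [e_n] freely and read off [F_n].  The choice is
    [e_3 = e_5 = 0], which gives [F_3 = a s] and [F_5 = a (F_4 + a^2 b)].
    Then [F_4] must be corrected after the change in degree 3: multiplying [D]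
    by [1 + P t^3], where [P = D_3 + a s] is a derivation, yields
    [F_4 = D_4 + a P] ([HS_normalize_deg3]).

    In degree 6 the recursion is silent, and one needs [F_6] with coboundary
    the sum of the [F_i x * F_j y] over [i + j = 6] and [i, j > 0].  Now
    [F_3] and [F_5] are expressed through [a], [b] and [c = F_4].  The
    coboundary of [b c] accounts for [b x * c y + c x * b y] and for every
    other term that contains [c].  What is left involves [a] and [b] only,
    and it is the coboundary of [b^2 s + s a^4 + a s b a] ([residue6M]).
    The change in degree 3 is what makes this possible: it replaces the term
    [D_3 x * D_3 y] by [a (s x) * a (s y)], which involves [a] and [b] only. *)

(** * Linear maps and sequences of maps *)

Section Sequences.
Variables (k A : comPzRingType) (phi : {rmorphism k -> A}).
Implicit Types (f g : A -> A) (E : nat -> A -> A).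

Lemma alg_linearD f : alg_linear phi f -> {morph f : x y / x + y}.
Proof. by move=> lf x y; have := lf 1 x y; rewrite rmorph1 !mul1r. Qed.

Lemma alg_linear_comp f g :
  alg_linear phi f -> alg_linear phi g -> alg_linear phi (fun x => f (g x)).
Proof. by move=> lf lg c x y; rewrite lg lf. Qed.

Lemma alg_linear_add f g :
  alg_linear phi f -> alg_linear phi g -> alg_linear phi (fun x => f x + g x).
Proof. by move=> lf lg c x y; rewrite lf lg; ring. Qed.

(** Indexing by [nat] turns the double sum over ordinals into a convolution
    that unfolds by computation in each degree. *)
Definition HS_seq (m : nat) E : Prop :=
  [/\ forall n, (n <= m)%N -> alg_linear phi (E n),
      E 0 = id
    & forall n x y, (n <= m)%N ->
        E n (x * y) = \sum_(i < n.+1) E i x * E (n - i)%N y].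

Lemma HS_seq_widen m n E : (n <= m)%N -> HS_seq m E -> HS_seq n E.
Proof.
move=> le_nm [linE E0 EM]; split=> // i => [|x y] le_in.
  exact/linE/(leq_trans le_in).
exact/EM/(leq_trans le_in).
Qed.

Lemma convolution_ord (m n : nat) (f g : nat -> A) : (n <= m)%N ->
  \sum_(i < m.+1) \sum_(j < m.+1 | (i + j == n)%N) f i * g j =
  \sum_(i < n.+1) f i * g (n - i)%N.
Proof.
move=> le_nm.
rewrite (big_ord_widen m.+1 (fun i => f i * g (n - i)%N)) //.
rewrite [RHS]big_mkcond /=; apply: eq_bigr => i _.
case: ifPn => [lt_in | ge_in].
  have lt_nim : (n - i < m.+1)%N by rewrite ltnS (leq_trans (leq_subr _ _)).
  rewrite (big_pred1 (Ordinal lt_nim)) // => j.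
  apply/eqP/eqP=> [ij_n | ->]; last by rewrite /= subnKC.
  by apply: val_inj; rewrite /= -ij_n addKn.
rewrite big_pred0 // => j; apply: contraNF ge_in => /eqP <-.
by rewrite ltnS leq_addr.
Qed.

Lemma HS_of_seq m E : HS_seq m E -> HS phi m (fun i : 'I_m.+1 => E i).
Proof.
case=> linE E0 EM; split=> [n | // | n x y]; first by apply: linE; rewrite -ltnS.
have le_nm : (n <= m)%N by rewrite -ltnS.
by rewrite EM // -(convolution_ord (E^~ x) (E^~ y) le_nm).
Qed.

Lemma seq_of_HS m (D : 'I_m.+1 -> A -> A) :
  HS phi m D -> HS_seq m (fun n => D (inord n)).
Proof.
case=> linD D0 DM; split=> [n _ | | n x y le_nm]; first exact: linD.
  by rewrite -D0; congr D; apply: val_inj; rewrite /= inordK.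
rewrite DM inordK // -(convolution_ord (fun i => D (inord i) x)
                                       (fun i => D (inord i) y) le_nm).
by apply: eq_bigr => i _; apply: eq_bigr => j _; rewrite !inord_val.
Qed.

Lemma IDerP m (d : A -> A) : (0 < m)%N ->
  IDer phi m d <-> Der phi d /\ exists2 E, HS_seq m E & E 1%N = d.
Proof.
move=> m_gt0; split=> -[derd [E HSE E1]]; split=> //.
  by exists (fun n => E (inord n)); first exact: seq_of_HS.
by exists (fun i => E i); [exact: HS_of_seq | rewrite inordK].
Qed.

End Sequences.

(** * Formulas in characteristic 2 *)

Section Formulas.
Variables (A : comPzRingType) (a b : A -> A).
Hypothesis char2 : 2%:R = 0 :> A.
Hypotheses (aD : {morph a : x y / x + y}) (bD : {morph b : x y / x + y}).
Hypothesis aM : forall x y, a (x * y) = a x * y + x * a y.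
Hypothesis bM : forall x y, b (x * y) = b x * y + a x * a y + x * b y.

Lemma char2_eq (x y : A) : x + y = 0 -> x = y.
Proof. by move=> xy0; rewrite -[x]addr0 -xy0; ring: char2. Qed.

Lemma char2_4 : 4%:R = 0 :> A.
Proof. by rewrite (natrM _ 2 2) char2 mul0r. Qed.

Lemma char2_6 : 6%:R = 0 :> A.
Proof. by rewrite (natrM _ 2 3) char2 mul0r. Qed.

(* [ring] erases a monomial only when its coefficient is literally one of
   those assumed to vanish.  Moving everything to one side makes the
   coefficients even; below they do not exceed 6. *)
Ltac char2_ring := apply: char2_eq; ring: char2 char2_4 char2_6.

Lemma derivation_sq x y : a (a (x * y)) = a (a x) * y + x * a (a y).
Proof. by rewrite !aM !aD !aM; char2_ring. Qed.

Lemma derivation_pow4 x y :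
  a (a (a (a (x * y)))) = a (a (a (a x))) * y + x * a (a (a (a y))).
Proof. by rewrite !derivation_sq !aD !derivation_sq; char2_ring. Qed.

Definition inv_coef2 x := b x + a (a x).
Local Notation s := inv_coef2.

Definition term3 x := a (s x).

Lemma HS_leibniz3 x y :
  term3 (x * y) = term3 x * y + b x * a y + a x * b y + x * term3 y.
Proof. by rewrite /term3 /s bM derivation_sq !aD !aM; char2_ring. Qed.

(** Degree 4 of the product of the given sequence with [1 + P t^3], where
    [P = D3 + term3]; degree 3 of that product is [D3 + P = term3]. *)
Lemma HS_normalize_deg3 (D3 D4 : A -> A) :
    (forall x y, D3 (x * y) = D3 x * y + b x * a y + a x * b y + x * D3 y) ->
    (forall x y,
       D4 (x * y) =
       D4 x * y + D3 x * a y + b x * b y + a x * D3 y + x * D4 y) ->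
  let c x := D4 x + a (D3 x + term3 x) in
  forall x y,
    c (x * y) = c x * y + term3 x * a y + b x * b y + a x * term3 y + x * c y.
Proof.
move=> D3M D4M c x y; rewrite /c HS_leibniz3 D3M D4M.
do !rewrite ?aD ?aM.
char2_ring.
Qed.

Section DegreesFiveSix.
Variable c : A -> A.
Hypothesis cM : forall x y,
  c (x * y) = c x * y + term3 x * a y + b x * b y + a x * term3 y + x * c y.

(** The degree 5 coefficient of [t F' = e F] with
    [e = a t + a^2 t^2 + a^4 t^4] is
    [F_5 = a F_4 + a^2 F_3 + a^4 F_1 = a F_4 + a^3 b]. *)
Definition term5 x := a (c x + a (a (b x))).

Lemma HS_leibniz5 x y :
  term5 (x * y) =
  term5 x * y + c x * a y + term3 x * b y + b x * term3 y + a x * c y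
  + x * term5 y.
Proof.
rewrite /term5 /term3 cM /term3 bM; do !rewrite ?aD ?derivation_sq ?aM.
char2_ring.
Qed.

Definition residue6 x := b (b (s x)) + s (a (a (a (a x)))) + a (s (b (a x))).

(** The bilinear part on the right is the sum of the [F_i x * F_j y] over
    [i + j = 6] and [i, j > 0] minus the coboundary of [b c].  The summands
    of [residue6] come from a linear system over the field with two elements,
    whose unknowns are the coefficients of the words of weight 6 in [a]
    (weight 1) and [b] (weight 2). *)
Lemma residue6M x y :
  residue6 (x * y) =
  residue6 x * y
  + (a (a (a (b x))) + b (a (s x))) * a y + b (b x) * b y
  + a (a (s x)) * a (a y) + b (a x) * a (s y)
  + a (b x) * a (b y) + a (s x) * a (s y)
  + a (s x) * b (a y) + a (a x) * a (a (s y))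
  + b x * b (b y) + a x * (a (a (a (b y))) + b (a (s y)))
  + x * residue6 y.
Proof.
rewrite /residue6 /s.
do !rewrite ?aD ?bD ?derivation_pow4 ?bM ?derivation_sq ?aM.
char2_ring.
Qed.

Definition term6 x := b (c x) + residue6 x.

Lemma HS_leibniz6 x y :
  term6 (x * y) =
  term6 x * y + term5 x * a y + c x * b y + term3 x * term3 y + b x * c y
  + a x * term5 y + x * term6 y.
Proof.
rewrite /term6 residue6M cM !bD !bM /term5 /term3 !aD.
char2_ring.
Qed.

End DegreesFiveSix.
End Formulas.

(** * Integration up to length 6 *)

Lemma HS_seq_extend46 (k A : comPzRingType) (phi : {rmorphism k -> A})
    (D : nat -> A -> A) :
  2%:R = 0 :> A -> HS_seq phi 4 D ->
  exists2 F, HS_seq phi 6 F & F 1%N = D 1%N.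
Proof.
move=> char2 [linD D0 DM].
set a := D 1%N; set b := D 2%N.
have [lina linb lin3 lin4] :
  [/\ alg_linear phi a, alg_linear phi b, alg_linear phi (D 3)
    & alg_linear phi (D 4)] by split; apply: linD.
have DME n x y : (n <= 4)%N ->
    D n (x * y) = \sum_(0 <= i < n.+1) D i x * D (n - i)%N y.
  by move=> le_n4; rewrite DM // big_mkord.
have aM x y : a (x * y) = a x * y + x * a y.
  by rewrite /a DME // !big_nat_recl // big_geq //= D0; ring.
have bM x y : b (x * y) = b x * y + a x * a y + x * b y.
  by rewrite /b /a DME // !big_nat_recl // big_geq //= D0; ring.
have D3M x y : D 3 (x * y) = D 3 x * y + b x * a y + a x * b y + x * D 3 y.
  by rewrite /b /a DME // !big_nat_recl // big_geq //= D0; ring.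
have D4M x y : D 4 (x * y) =
    D 4 x * y + D 3 x * a y + b x * b y + a x * D 3 y + x * D 4 y.
  by rewrite /b /a DME // !big_nat_recl // big_geq //= D0; ring.
have [aD bD] := (alg_linearD lina, alg_linearD linb).
pose c x := D 4 x + a (D 3 x + term3 a b x).
have cM : forall x y, c (x * y) =
    c x * y + term3 a b x * a y + b x * b y + a x * term3 a b y + x * c y.
  exact: HS_normalize_deg3.
have lins : alg_linear phi (inv_coef2 a b).
  by apply: alg_linear_add => //; apply: alg_linear_comp.
have lint3 : alg_linear phi (term3 a b) by apply: alg_linear_comp.
have linc : alg_linear phi c.
  apply: alg_linear_add => //; apply: (alg_linear_comp lina).
  exact: alg_linear_add.
have lina2 : alg_linear phi (fun x => a (a x)) by apply: alg_linear_comp.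
have lint5 : alg_linear phi (term5 a b c).
  apply: (alg_linear_comp lina); apply: alg_linear_add => //.
  exact: (alg_linear_comp lina2 linb).
have lint6 : alg_linear phi (term6 a b c).
  apply: alg_linear_add; first exact: alg_linear_comp.
  apply: alg_linear_add; last first.
    apply: (alg_linear_comp lina); apply: (alg_linear_comp lins).
    exact: alg_linear_comp.
  apply: alg_linear_add; last first.
    exact: (alg_linear_comp lins (alg_linear_comp lina2 lina2)).
  by apply: (alg_linear_comp linb); apply: alg_linear_comp.
pose F := nth id [:: id; a; b; term3 a b; c; term5 a b c; term6 a b c].
exists F => //; split=> [n | // | n x y le_n6].
  by do 7?[case: n => [|n] //].
rewrite -(big_mkord xpredT (fun i => F i x * F (n - i)%N y)).
do 7?[case: n le_n6 => [|n] le_n6 //];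
  rewrite !big_nat_recl // big_geq //= /F /=.
- by ring.
- by rewrite aM; ring.
- by rewrite bM; ring.
- by rewrite HS_leibniz3 //; ring.
- by rewrite cM; ring.
- by rewrite HS_leibniz5 //; ring.
- by rewrite HS_leibniz6 //; ring.
Qed.

Theorem proposition2p3 (k : comNzRingType) (char2 : 2%N \in [pchar k])
    (A : comPzRingType) (phi : {rmorphism k -> A}) :
  IDer phi 5 = IDer phi 6.
Proof.
have char2A : 2%:R = 0 :> A by rewrite -(rmorph_nat phi) pcharf0 // rmorph0.
apply/seteqP; split=> d /IDerP-/(_ isT)[derd [D HSD D1]];
  apply/IDerP => //; split=> //.
  have [F HSF F1] := HS_seq_extend46 char2A (HS_seq_widen (leqnSn 4) HSD).
  by exists F; rewrite ?F1.
by exists D => //; apply: HS_seq_widen HSD.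
Qed.
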